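(* Let $E_1$, $E_2$ and $F$ be locally convex spaces. If $F$ has the countable neighbourhood property, then every continuous bilinear map $\beta\colon E_1\times E_2\to F$ admits product estimates.
   Context: A locally convex space is a Hausdorff locally convex real topological vector space; $\mathbb{N}=\{1,2,\ldots\}$. Continuity of a bilinear map means joint continuity. Countable neighbourhood property: for continuous seminorms $p,q$ on a locally convex space $E$, write $p\preceq q$ if there is $C>0$ with $p\leq Cq$ pointwise. $E$ has the countable neighbourhood property if for each countable set $P$ of continuous seminorms on $E$ there is a continuous seminorm $q$ on $E$ with $p\preceq q$ for all $p\in P$. Product estimates: a bilinear map $\beta\colon E_1\times E_2\to F$ between locally convex spaces admits product estimates if for each double sequence $(p_{i,j})_{i,j\in\mathbb{N}}$ of continuous seminorms on $F$ there exist a sequence $(p_i)_{i\in\mathbb{N}}$ of continuous seminorms on $E_1$ and a sequence $(q_j)_{j\in\mathbb{N}}$ of continuous seminorms on $E_2$ such that $p_{i,j}(\beta(x,y))\leq p_i(x)q_j(y)$ for all $i,j\in\mathbb{N}$, $x\in E_1$, $y\in E_2$. *)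

(* Defs.v *)
From mathcomp Require Export all_boot all_order all_algebra.
From mathcomp Require Export all_classical all_reals all_analysis.

Set Implicit Arguments.
Unset Strict Implicit.
Unset Printing Implicit Defensive.

Export Order.TTheory GRing.Theory Num.Theory.
Export numFieldNormedType.Exports.

Local Open Scope classical_set_scope.
Local Open Scope ring_scope.

Definition seminorm (R : realType) (E : lmodType R) (p : E -> R) : Prop :=
  [/\ (forall x, 0 <= p x),
      (forall x y, p (x + y) <= p x + p y) &
      (forall (a : R) x, p (a *: x) = `|a| * p x)].

Definition continuous_seminorm (R : realType) (E : tvsType R) (p : E -> R)
    : Prop :=
  seminorm p /\ continuous p.

Definition seminorm_preceq (R : realType) (E : lmodType R) (p q : E -> R)
    : Prop :=
  exists2 C : R, 0 < C & forall x, p x <= C * q x.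

Definition countable_neighbourhood_property (R : realType) (E : tvsType R)
    : Prop :=
  forall P : set (E -> R),
    countable P -> P `<=` @continuous_seminorm R E ->
    exists2 q : E -> R, continuous_seminorm q &
      forall p, P p -> seminorm_preceq p q.

(* Sequences are indexed from 0 here; the indices serve only as labels. *)
Definition admits_product_estimates (R : realType) (E1 E2 F : tvsType R)
    (beta : E1 -> E2 -> F) : Prop :=
  forall p : nat -> nat -> F -> R,
    (forall i j, continuous_seminorm (p i j)) ->
    exists (p1 : nat -> E1 -> R) (q : nat -> E2 -> R),
      [/\ (forall i, continuous_seminorm (p1 i)),
          (forall j, continuous_seminorm (q j)) &
          forall i j x y, p i j (beta x y) <= p1 i x * q j y].

(* Main.v *)
Require Import Defs.

Set Implicit Arguments.
Unset Strict Implicit.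

Local Open Scope classical_set_scope.
Local Open Scope ring_scope.

(** The countable neighbourhood property replaces the whole double sequence
    [p i j] by one continuous seminorm [q] on [F]: one has
    [p i j <= c i j * q] for some constants [c i j].  It then suffices to
    separate variables twice.

    The constants separate by a diagonal argument: with [a n] at least 1 and
    at least every [c i j] with [i, j <= n], the entry [c i j] is bounded by
    [a (maxn i j)], one of the two factors of [a i * a j]
    ([double_sequence_le_mul]).

    The function [q (beta x y)] is a seminorm in each variable, bounded by 1 on
    a product [U `*` V] of neighbourhoods of 0.  It is bounded by [r x * s y]
    for continuous seminorms [r] and [s] ([separate_seminorm_le_mul]), which
    are obtained as suprema: [r x] is the supremum over [y] in [V], and then
    [s y] is the supremum over the unit ball of [r].  A finite supremum of
    seminorms is a seminorm, and it is continuous as soon as it is bounded by 1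
    on a neighbourhood of 0 ([sup_continuous_seminorm]).

    Hence [p i j (beta x y) <= (a i * r x) * (a j * s y)]. *)

Lemma absorbing_nbhs0 (R : realType) (E : tvsType R) (U : set E) (x : E) :
  nbhs 0 U -> exists2 t : R, 0 < t & U (t *: x).
Proof.
move=> U0.
have := @scale_continuous R E (0, x) U; rewrite /= scale0r => /(_ U0).
move=> [[A B] /= [/nbhs_ballP[e /= e0 eA] /nbhs_singleton Bx] ABU].
exists (e / 2); first by rewrite divr_gt0.
apply: (ABU (e / 2, x)); split=> //=; apply: eA.
rewrite /ball /= sub0r normrN gtr0_norm ?divr_gt0//.
by rewrite ltr_pdivrMr// ltr_pMr// ltr1n.
Qed.

Lemma seminorm0 (R : realType) (E : lmodType R) (p : E -> R) :
  seminorm p -> p 0 = 0.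
Proof. by move=> [_ _ pZ]; rewrite -(scale0r (0 : E)) pZ normr0 mul0r. Qed.

(** By homogeneity [p] is at most [e] on [e *: U], and the triangle inequality
    carries this bound at 0 to every other point. *)
Lemma seminorm_continuous (R : realType) (E : tvsType R) (p : E -> R)
    (U : set E) :
  seminorm p -> nbhs 0 U -> (forall x, U x -> p x <= 1) -> continuous p.
Proof.
move=> sp U0 pU x; have [p_ge0 pD pZ] := sp.
apply/cvgrPdist_le => e e0.
have eU0 : nbhs (0 : E) ( *:%R e @` U) by apply: nbhs0Z => //; rewrite gt_eqF.
apply: filterS (nbhsT x eU0) => _ [_ [u Uu <-] <-].
have peu : p (e *: u) <= e.
  by rewrite pZ gtr0_norm// ler_piMr ?pU// ltW.
rewrite ler_distl; apply/andP; split.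
  by rewrite lerBlDr (le_trans (pD _ _))// lerD2l.
have := pD (x + e *: u) (- 1 *: (e *: u)).
rewrite pZ normrN1 mul1r scaleN1r addrK => /le_trans; apply.
by rewrite lerD2l.
Qed.

Lemma continuous_seminormZ (R : realType) (E : tvsType R) (p : E -> R)
    (a : R) :
  0 <= a -> continuous_seminorm p -> continuous_seminorm (fun x => a * p x).
Proof.
move=> a0 [[p_ge0 pD pZ] pc]; split.
  split=> [x|x y|b x].
  - by rewrite mulr_ge0.
  - by rewrite -mulrDr ler_wpM2l.
  - by rewrite pZ mulrCA.
by move=> x; apply: cvgM; [exact: cvg_cst|exact: pc].
Qed.

(** Absorption of every point by [U] makes the suprema finite everywhere, not
    only on [U]. *)
Lemma sup_continuous_seminorm (R : realType) (E : tvsType R) (I : Type)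
    (D : set I) (f : I -> E -> R) (U : set E) :
    D !=set0 -> (forall i, D i -> seminorm (f i)) -> nbhs 0 U ->
    (forall i x, D i -> U x -> f i x <= 1) ->
  exists p : E -> R, [/\ continuous_seminorm p,
    (forall i x, D i -> f i x <= p x) &
    (forall x c, (forall i, D i -> f i x <= c) -> p x <= c)].
Proof.
move=> [i0 Di0] sf U0 fU; pose p x := sup [set f i x | i in D].
have ub x : has_ubound [set f i x | i in D].
  have [t t0 Ux] := absorbing_nbhs0 x U0.
  exists t^-1 => _ [i Di <-].
  have [_ _ fZ] := sf i Di.
  have := fU i _ Di Ux.
  by rewrite fZ gtr0_norm// -ler_pdivlMl// mulr1.
have le_p i x : D i -> f i x <= p x.
  by move=> Di; apply: ub_le_sup => //; exists i.
have p_le x c : (forall i, D i -> f i x <= c) -> p x <= c.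
  move=> fc; apply: ge_sup; first by exists (f i0 x), i0.
  by move=> _ [i Di <-]; exact: fc.
have p_ge0 x : 0 <= p x.
  by apply: le_trans (le_p i0 x Di0); have [] := sf i0 Di0.
have pZ_le (a : R) x : p (a *: x) <= `|a| * p x.
  apply: p_le => i Di; have [_ _ ->] := sf i Di.
  by rewrite ler_wpM2l// le_p.
have sp : seminorm p.
  split=> [//|x y|a x].
    apply: p_le => i Di; have [_ fD _] := sf i Di.
    by rewrite (le_trans (fD _ _))// lerD// le_p.
  apply/eqP; rewrite eq_le pZ_le /=.
  have [->|a0] := eqVneq a 0; first by rewrite normr0 mul0r.
  (* the reverse inequality is the one just proved, for the scalar [a^-1] *)
  have := pZ_le a^-1 (a *: x).
  by rewrite scalerA mulVf// scale1r normfV ler_pdivlMl ?normr_gt0.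
exists p; split=> //; split=> //.
by apply: (seminorm_continuous sp U0) => x Ux; apply: p_le => i Di; exact: fU.
Qed.

Lemma double_sequence_le_mul (R : realType) (c : nat -> nat -> R) :
  exists2 a : nat -> R, (forall n, 0 <= a n) &
    forall i j, c i j <= a i * a j.
Proof.
pose a n : R := 1 + \sum_(i < n.+1) \sum_(j < n.+1) `|c i j|.
have row_ge0 n i : 0 <= \sum_(j < n) `|c i j| by apply: sumr_ge0 => j _.
have a_ge1 n : 1 <= a n by rewrite lerDl sumr_ge0.
have c_le n i j : (i <= n)%N -> (j <= n)%N -> c i j <= a n.
  rewrite -ltnS => lin; rewrite -ltnS => ljn.
  rewrite /a (bigD1 (Ordinal lin))//= (bigD1 (Ordinal ljn))//=.
  rewrite ler_wpDl// -addrA ler_wpDr ?ler_norm//.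
  by apply: addr_ge0; apply: sumr_ge0 => k _; rewrite ?row_ge0.
exists a => [n|i j]; first exact: le_trans (a_ge1 n).
have [ij|/ltnW ji] := leqP i j.
  by rewrite (le_trans (c_le j _ _ ij _))// ler_peMl// (le_trans _ (a_ge1 j)).
by rewrite (le_trans (c_le i _ _ _ ji))// ler_peMr// (le_trans _ (a_ge1 i)).
Qed.

(** Take [r x] to be the supremum of [Q x y] over [y] in [V], and [s y] the
    supremum of [Q x y] over the unit ball of [r].  The latter is at most 1 on
    [V], since [Q x y <= r x] there, so [s] is again continuous.  If
    [t > r x], then [t^-1 *: x] lies in that ball and [Q x y <= t * s y];
    letting [t] decrease to [r x] also covers the points where [r] vanishes. *)
Lemma separate_seminorm_le_mul (R : realType) (E1 E2 : tvsType R)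
    (Q : E1 -> E2 -> R) (U : set E1) (V : set E2) :
    (forall y, seminorm (Q^~ y)) -> (forall x, seminorm (Q x)) ->
    nbhs 0 U -> nbhs 0 V -> (forall x y, U x -> V y -> Q x y <= 1) ->
  exists (r : E1 -> R) (s : E2 -> R),
    [/\ continuous_seminorm r, continuous_seminorm s &
        forall x y, Q x y <= r x * s y].
Proof.
move=> Q1 Q2 U0 V0 QUV.
have [|//|y x Vy Ux|r [cr Qr _]] :=
    @sup_continuous_seminorm R E1 _ V (fun y x => Q x y) U _ _ U0.
- by exists 0; exact: nbhs_singleton.
- exact: QUV.
have [sr _] := cr; have [r_ge0 _ rZ] := sr.
have [|//|x y rx Vy|s [cs Qs _]] :=
    @sup_continuous_seminorm R E2 _ [set x | r x <= 1] Q V _ _ V0.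
- by exists 0; rewrite /= (seminorm0 sr).
- exact: le_trans (Qr y x Vy) rx.
have [[s_ge0 _ _] _] := cs.
exists r, s; split=> // x y.
have Q_le t : r x < t -> Q x y <= t * s y.
  move=> rt; have t0 : 0 < t by exact: le_lt_trans rt.
  have [_ _ QZ] := Q1 y.
  have := Qs (t^-1 *: x) y.
  rewrite QZ /= rZ normfV gtr0_norm// !ler_pdivrMl// mulr1.
  by apply; exact: ltW.
apply/ler_addgt0Pr => e e0.
have s1 : 0 < s y + 1 by rewrite ltr_wpDl.
have d0 : 0 < e / (s y + 1) by rewrite divr_gt0.
apply: (le_trans (Q_le (r x + e / (s y + 1)) _)); first by rewrite ltrDl.
rewrite mulrDl lerD2l mulrAC ler_pdivrMr// ler_wpM2l// ?ltW//.
by rewrite ltrDl.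
Qed.

Lemma bilinear_seminorm_le_mul (R : realType) (E1 E2 F : tvsType R)
    (beta : {bilinear E1 -> E2 -> F}) (q : F -> R) :
    continuous (fun xy : E1 * E2 => beta xy.1 xy.2) -> continuous_seminorm q ->
  exists (r : E1 -> R) (s : E2 -> R),
    [/\ continuous_seminorm r, continuous_seminorm s &
        forall x y, q (beta x y) <= r x * s y].
Proof.
move=> betac [sq qc]; have [q_ge0 qD qZ] := sq.
have qbetac : {for (0, 0), continuous (fun xy : E1 * E2 => q (beta xy.1 xy.2))}.
  by apply: (@continuous_comp _ _ _ _ q); [exact: betac|exact: qc].
have q00 : q (beta 0 0) = 0 by rewrite linear0l (seminorm0 sq).
have : nbhs ((0, 0) : E1 * E2) [set xy | q (beta xy.1 xy.2) < 1].
  by apply: (cvgr_lt _ qbetac); rewrite /= q00.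
move=> [[U V] /= [U0 V0] UV].
apply: (@separate_seminorm_le_mul R E1 E2 (fun x y => q (beta x y)) U V) => //.
- by move=> y; split=> [//|x x'|a x]; rewrite ?linearDl ?linearZl_LR.
- by move=> x; split=> [//|y y'|a y]; rewrite ?linearDr ?linearZr_LR.
- by move=> x y Ux Vy; apply/ltW/(UV (x, y)).
Qed.

(* [tvsType] is locally convex but does not include the Hausdorff axiom. *)
Theorem proposition4p5 (R : realType) (E1 E2 F : tvsType R)
    (hE1 : hausdorff_space E1) (hE2 : hausdorff_space E2)
    (hF : hausdorff_space F)
    (hcnp : countable_neighbourhood_property F)
    (beta : {bilinear E1 -> E2 -> F})
    (hbeta : continuous (fun xy : E1 * E2 => beta xy.1 xy.2)) :
  admits_product_estimates beta.
Proof.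
move=> p cp.
have [| |q cq pq] := hcnp (range (fun ij : nat * nat => p ij.1 ij.2)).
- exact: card_le_trans (card_image_le _ _) (countableP _).
- by move=> _ [ij _ <-].
have /choice[c pc] (ij : nat * nat) :
    exists c : R, forall z, p ij.1 ij.2 z <= c * q z.
  by have [|c _ pc] := pq (p ij.1 ij.2); [exists ij|exists c].
have [a a_ge0 ca] := double_sequence_le_mul (fun i j => c (i, j)).
have [r [s [cr cs qrs]]] := bilinear_seminorm_le_mul hbeta cq.
exists (fun i x => a i * r x), (fun j y => a j * s y); split=> [i|j|i j x y].
- exact: continuous_seminormZ.
- exact: continuous_seminormZ.
have [[q_ge0 _ _] _] := cq.
rewrite mulrACA (le_trans (pc (i, j) _))//.
rewrite (le_trans (ler_wpM2r (q_ge0 _) (ca i j)))//.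
by rewrite ler_wpM2l// mulr_ge0.
Qed.
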